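(* Let $p$ be an odd prime. Then $$\sum_{k=0}^{p-1}\frac{(q;q^2)_k^2 }{(q^2;q^2)_k^2}q^{2k} \equiv \left(\frac{-1}{p}\right)q^{\frac{p^2-1}{4}}\pmod{[p]^2}.$$
   Context: $q$ is an indeterminate. $(a;q)_0=1$ and $(a;q)_n=(1-a)(1-aq)\cdots(1-aq^{n-1})$ for $n\ge 1$; so $(a;q^m)_n=\prod_{j=0}^{n-1}(1-aq^{mj})$. $\left(\frac{\cdot}{p}\right)$ is the Legendre symbol modulo $p$. $[p]=1+q+\cdots+q^{p-1}$, which is irreducible in $\mathbb{Q}[q]$ for $p$ prime. For rational functions $A(q),B(q)\in\mathbb{Q}(q)$ whose denominators are relatively prime to $[p]$, $A\equiv B\pmod{[p]^r}$ means that $A-B$ can be written as a fraction whose numerator is divisible by $[p]^r$ in $\mathbb{Q}[q]$ and whose denominator is relatively prime to $[p]$. *)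

(* Defs.v *)
From mathcomp Require Import all_boot all_order all_algebra.

Set Implicit Arguments.
Unset Strict Implicit.
Unset Printing Implicit Defensive.

Import Order.TTheory GRing.Theory Num.Theory.
Local Open Scope ring_scope.

(* The field Q(q); the indeterminate q is the image of the variable 'X. *)
Notation Qq := {fraction {poly rat}}.

Definition q : Qq := tofrac ('X : {poly rat}).

(* (a; b)_n, so that (a; q^m)_n is qpoch a (q ^+ m) n. *)
Definition qpoch (a b : Qq) (n : nat) : Qq := \prod_(j < n) (1 - a * b ^+ j).

(* The q-integer [n] = 1 + q + ... + q^(n-1), as an element of Q[q]. *)
Definition qint (n : nat) : {poly rat} := \sum_(i < n) 'X^i.

(* A = B (mod [p]^r), for A and B with denominators prime to [p]. *)
Definition qcong (p r : nat) (A B : Qq) : Prop :=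
  exists N D : {poly rat},
    [/\ D != 0, coprimep D (qint p), qint p ^+ r %| N & A - B = tofrac N / tofrac D].

(* The Legendre symbol (a | p); meaningful for p an odd prime. *)
Definition legendre (a : int) (p : nat) : int :=
  if (p %| a)%Z then 0
  else if [exists x : 'I_p, (x%:Z ^+ 2 == a %[mod p])%Z] then 1
  else -1.

(* Main.v *)
Require Import Defs.
From mathcomp Require Import all_boot all_order all_algebra.
From mathcomp Require Import finfield ring zify.

(** Write p = 2m+1 and Q = q^2.  The numerator (q; Q)_k^2 is the product over
    j < k of (1 - q Q^j)^2.  Shifting the two equal factors in opposite
    directions, to 1 - q^(1-p) Q^j and 1 - q^(1+p) Q^j, changes their product
    only by a multiple of (1 - q^p)^2 ([shifted_factors]), that is, by a
    multiple of [p]^2.  As q^(1-p) = Q^(-m) and q^(1+p) = Q^(m+1), and as the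
    denominators (Q; Q)_k with k < p are prime to [p], the sum is congruent
    modulo [p]^2 to

      sum_k (Q^(-m); Q)_k (Q^(m+1); Q)_k / (Q; Q)_k^2 * Q^k.

    This is a terminating basic hypergeometric series, whose terms vanish for
    k > m, and the q-Chu-Vandermonde identity ([q_chu_vandermonde]) sums it
    exactly, to (-1)^m Q^(m(m+1)/2).  Finally m(m+1) = (p^2 - 1)/4, and (-1)^m
    is the Legendre symbol of -1 ([legendreN1]). *)

Set Implicit Arguments.
Unset Strict Implicit.
Unset Printing Implicit Defensive.

Import GRing.Theory.

Local Open Scope ring_scope.

(** * The q-Chu-Vandermonde summation *)

Section ChuVandermonde.

Variable F : fieldType.
Implicit Types a b c Q : F.

(** The symbol (a; b)_n of [qpoch], over any field: the summation formula is
    an identity of rational functions, and at the base field Q(q) the two are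
    convertible. *)
Definition qfact a b n : F := \prod_(j < n) (1 - a * b ^+ j).

Lemma qfact0 a b : qfact a b 0 = 1.
Proof. by rewrite /qfact big_ord0. Qed.

Lemma qfactSr a b n : qfact a b n.+1 = qfact a b n * (1 - a * b ^+ n).
Proof. by rewrite /qfact big_ord_recr. Qed.

Lemma qfactSl a b n : qfact a b n.+1 = (1 - a) * qfact (a * b) b n.
Proof.
rewrite /qfact big_ord_recl expr0 mulr1; congr (_ * _).
by apply: eq_bigr => i _; rewrite exprS mulrA.
Qed.

Lemma qfact_neq0 a b n : (forall k, 1 - a * b ^+ k != 0) -> qfact a b n != 0.
Proof. by move=> nz; apply/prodf_neq0 => i _. Qed.

Lemma qfactM a b Q n : qfact a Q n * qfact b Q n
  = \prod_(j < n) ((1 - a * Q ^+ j) * (1 - b * Q ^+ j)).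
Proof. by rewrite -big_split. Qed.

Lemma exprVS Q n : Q != 0 -> Q ^- n.+1 * Q = Q ^- n.
Proof. by move=> Q0; rewrite exprS invfM mulrAC mulVf ?mul1r. Qed.

(** Induction on n.  Let t(n, k) = (Q^(-n); Q)_k / (Q; Q)_k.  The two symbols
    (Q^(-n-1); Q)_(k+1) and (Q^(-n); Q)_(k+1) share the factor (Q^(-n); Q)_k,
    which gives the Pascal-type rule
    t(n+1, k+1) = t(n, k+1) - Q^(-n-1) t(n, k).
    Summed against the remaining factors, it expresses the series for n+1
    through the series for n at (a, c) and at (aQ, cQ); the closed form
    satisfies the same recurrence.  The upper bound N can be any number above
    n because (Q^(-n); Q)_k = 0 for k > n. *)
Lemma q_chu_vandermonde Q a c n N :
  Q != 0 -> a != 0 ->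
  (forall k, 1 - Q * Q ^+ k != 0) -> (forall k, 1 - c * Q ^+ k != 0) ->
  (n < N)%N ->
  \sum_(0 <= k < N) qfact (Q ^- n) Q k * qfact a Q k
      / (qfact Q Q k * qfact c Q k) * Q ^+ k
  = a ^+ n * qfact (c / a) Q n / qfact c Q n.
Proof.
move=> Q0 a0 nzQ; elim: n N a c a0 => [|n IHn] [//|N] a c a0 nzc ltnN.
  rewrite big_nat_recl // big1 => [|k _]; last first.
    by rewrite qfactSl expr0 invr1 subrr !mul0r.
  by rewrite !qfact0 expr0 !mulr1 invr1 addr0.
have c1 : 1 - c != 0 by have := nzc 0%N; rewrite expr0 mulr1.
have nzcQ k : 1 - c * Q * Q ^+ k != 0 by rewrite -mulrA -exprS.
(* The shift from k to k+1 lowers the upper bound of the last sum by one. *)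
have step : \sum_(0 <= k < N.+1) qfact (Q ^- n.+1) Q k * qfact a Q k
      / (qfact Q Q k * qfact c Q k) * Q ^+ k
  = \sum_(0 <= k < N.+1) qfact (Q ^- n) Q k * qfact a Q k
      / (qfact Q Q k * qfact c Q k) * Q ^+ k
    - Q ^- n * (1 - a) / (1 - c)
      * \sum_(0 <= k < N) qfact (Q ^- n) Q k * qfact (a * Q) Q k
          / (qfact Q Q k * qfact (c * Q) Q k) * Q ^+ k.
  rewrite !(big_nat_recl N) // !qfact0 -addrA; congr (_ + _).
  rewrite mulr_sumr -sumrB; apply: eq_bigr => k _.
  rewrite (qfactSl (Q ^- n.+1)) (qfactSr (Q ^- n)) (qfactSl a) (qfactSr Q).
  rewrite (qfactSl c) exprVS //.
  have := nzQ k; have := qfact_neq0 k nzQ; have := qfact_neq0 k nzcQ.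
  move: (qfact (c * Q) Q k) (qfact Q Q k) (qfact (a * Q) Q k) (qfact (Q ^- n) Q k).
  move=> C D A B; rewrite !exprS.
  have := expf_neq0 n Q0; move: (Q ^+ n) (Q ^+ k) => u v.
  by move=> u0 C0 D0 v0; field; rewrite u0 C0 D0 v0 c1 Q0.
rewrite {}step IHn ?(IHn N) ?mulf_neq0 //; last exact: ltnW.
have -> : c * Q / (a * Q) = c / a by field; rewrite Q0 a0.
have -> : qfact (c * Q) Q n = qfact c Q n.+1 / (1 - c).
  by rewrite qfactSl mulrAC mulfV ?mul1r.
rewrite !(qfactSr _ _ n) exprMn !exprS.
have := nzc n; have := expf_neq0 n Q0; move: (Q ^+ n) => u u0 cu0.
move: (qfact c Q n) (qfact_neq0 n nzc) (qfact (c / a) Q n) (a ^+ n).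
move=> C C0 D an.
by field; rewrite u0 cu0 C0 c1 a0.
Qed.

(** Reversal of a product: 1 - Q^(-i) = - Q^(-i) (1 - Q^i) for i = 1, ..., n,
    and the exponents i add up to 'C(n+1, 2). *)
Lemma qfact_pow_opp Q n : Q != 0 ->
  Q ^+ 'C(n.+1, 2) * qfact (Q ^- n) Q n = (-1) ^+ n * qfact Q Q n.
Proof.
move=> Q0; elim: n => [|n IHn]; first by rewrite !qfact0 !expr0 !mulr1.
rewrite qfactSl qfactSr exprVS // binS bin1 exprD.
rewrite [(1 - _) * _]mulrC mulrACA IHn mulrBr mulr1 mulfV ?expf_neq0 //.
by rewrite !exprS; ring.
Qed.

(** At a = Q^(n+1) and c = Q the quotient c / a is Q^(-n), so that the closed
    form becomes a signed power of Q by [qfact_pow_opp]. *)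
Lemma q_chu_vandermonde_diag Q n N :
  Q != 0 -> (forall k, 1 - Q * Q ^+ k != 0) -> (n < N)%N ->
  \sum_(0 <= k < N) qfact (Q ^- n) Q k * qfact (Q ^+ n.+1) Q k
      / (qfact Q Q k * qfact Q Q k) * Q ^+ k
  = (-1) ^+ n * Q ^+ 'C(n.+1, 2).
Proof.
move=> Q0 nzQ ltnN; rewrite q_chu_vandermonde ?expf_neq0 //.
have -> : Q / Q ^+ n.+1 = Q ^- n by rewrite exprS invfM mulVKf.
have -> : (Q ^+ n.+1) ^+ n = Q ^+ 'C(n.+1, 2) * Q ^+ 'C(n.+1, 2).
  by rewrite -exprM -exprD addnn -mul2n -mul_bin_diag bin1.
by rewrite -(mulrA (Q ^+ _)) qfact_pow_opp // mulrA mulfK ?qfact_neq0 // mulrC.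
Qed.

End ChuVandermonde.

(** * Congruences modulo a power of [p] *)

(** Two readings of [qcong] organise what follows: [qcong p 0 A 0] says that A
    lies in the ring of fractions with denominator prime to [p], and
    [qcong p r A 0] that A lies in the ideal generated by [p]^r in that ring. *)

Section Congruences.

Variable p : nat.

Lemma qcongE r (A B : Qq) : qcong p r (A - B) 0 <-> qcong p r A B.
Proof. by rewrite /qcong subr0. Qed.

Lemma qcong0D r (A B : Qq) :
  qcong p r A 0 -> qcong p r B 0 -> qcong p r (A + B) 0.
Proof.
move=> [N [D [D0 Dp pN]]]; rewrite subr0 => ->.
move=> [N' [D' [D'0 D'p pN']]]; rewrite subr0 => ->.
exists (N * D' + N' * D), (D * D'); split.
- by rewrite mulf_neq0.
- by rewrite coprimepMl Dp D'p.
- by rewrite dvdp_addr ?dvdp_mulr.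
- by rewrite subr0 addf_div ?tofrac_eq0 // !(rmorphD, rmorphM).
Qed.

Lemma qcong0M r s (A B : Qq) :
  qcong p r A 0 -> qcong p s B 0 -> qcong p (r + s) (A * B) 0.
Proof.
move=> [N [D [D0 Dp pN]]]; rewrite subr0 => ->.
move=> [N' [D' [D'0 D'p pN']]]; rewrite subr0 => ->.
exists (N * N'), (D * D'); split.
- by rewrite mulf_neq0.
- by rewrite coprimepMl Dp D'p.
- by rewrite exprD dvdp_mul.
- by rewrite subr0 mulf_div !rmorphM.
Qed.

Lemma qcong0Mr r (A B : Qq) :
  qcong p r A 0 -> qcong p 0 B 0 -> qcong p r (A * B) 0.
Proof. by move=> A0 B0; rewrite -[r]addn0; apply: qcong0M. Qed.

Lemma qcong0_poly r (P : {poly rat}) : qint p ^+ r %| P -> qcong p r (tofrac P) 0.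
Proof.
by exists P, 1; rewrite subr0 rmorph1 divr1 oner_neq0 coprime1p.
Qed.

Lemma qcong0_local (P : {poly rat}) : qcong p 0 (tofrac P) 0.
Proof. by apply: qcong0_poly; rewrite dvd1p. Qed.

Lemma qcong0_1B (A : Qq) : qcong p 0 A 0 -> qcong p 0 (1 - A) 0.
Proof.
have -> : 1 - A = tofrac 1 + tofrac (-1) * A by rewrite rmorph1 rmorphN1 mulN1r.
move=> A0; apply: qcong0D; first exact: qcong0_local.
by apply: qcong0Mr => //; apply: qcong0_local.
Qed.

Lemma qcong0_inv (P : {poly rat}) :
  P != 0 -> coprimep P (qint p) -> qcong p 0 (tofrac P)^-1 0.
Proof. by exists 1, P; rewrite subr0 rmorph1 div1r expr0 dvd1p. Qed.

Lemma qcong0_sum r N (F : nat -> Qq) :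
  (forall k, (k < N)%N -> qcong p r (F k) 0) ->
  qcong p r (\sum_(0 <= k < N) F k) 0.
Proof.
move=> F0; rewrite big_nat; apply: (big_ind (fun A => qcong p r A 0)).
- by rewrite -(rmorph0 (@tofrac _)); apply: qcong0_poly; rewrite dvdp0.
- by move=> A B; apply: qcong0D.
- by move=> k /F0.
Qed.

Lemma qcong_prod r n (F G : nat -> Qq) :
  (forall j, qcong p 0 (F j) 0) -> (forall j, qcong p 0 (G j) 0) ->
  (forall j, qcong p r (F j) (G j)) ->
  qcong p r (\prod_(j < n) F j) (\prod_(j < n) G j).
Proof.
move=> F0 G0 FG; elim: n => [|n IHn].
  by rewrite !big_ord0 -qcongE subrr -(rmorph0 (@tofrac _));
    apply: qcong0_poly; rewrite dvdp0.
rewrite !big_ord_recr /= -qcongE.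
set A := \prod_(i < n) _; set B := \prod_(i < n) _.
have -> : A * F n - B * G n = (A - B) * F n + B * (F n - G n) by ring.
apply: qcong0D; first by apply: qcong0Mr; rewrite ?qcongE.
rewrite mulrC; apply: qcong0Mr; first by rewrite qcongE.
rewrite /B; elim: (n) => [|k IHk].
  by rewrite big_ord0 -(rmorph1 (@tofrac _)); apply: qcong0_local.
by rewrite big_ord_recr; apply: qcong0Mr.
Qed.

End Congruences.

(** * Factors prime to [p] *)

Lemma qintM n : (1 - 'X) * qint n = 1 - 'X^n.
Proof. by rewrite -[1 - 'X^n]opprB subrX1 -mulNr opprB. Qed.

Lemma qint_at0 n : (0 < n)%N -> (qint n).[0] = 1.
Proof.
case: n => // n _; rewrite /qint big_ord_recl hornerD hornerXn horner_sum.
by rewrite big1 ?addr0 // => i _; rewrite hornerXn expr0n.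
Qed.

Lemma qint_at1 n : (qint n).[1] = n%:R.
Proof.
rewrite /qint horner_sum -[n in RHS]card_ord -sumr_const.
by apply: eq_bigr => i _; rewrite hornerXn expr1n.
Qed.

Lemma coprime_X_qint n : (0 < n)%N -> coprimep 'X (qint n).
Proof. by move=> n0; rewrite coprimep_sym coprimepX rootE qint_at0. Qed.

(** If j u = v n + 1, then 1 - X^j divides 1 - X^(v n + 1), which is congruent
    to 1 - X modulo [n], and 1 - X is prime to [n] because [n] takes the nonzero
    value n at 1. *)
Lemma coprime_subX_qint n j :
  (0 < n)%N -> (0 < j)%N -> coprime j n -> coprimep (1 - 'X^j) (qint n).
Proof.
move=> n0 j0; have [u v + _ jn] := egcdnP n j0; rewrite (eqP jn) => uv.
have dvdX (P : {poly rat}) k : 1 - P %| 1 - P ^+ k.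
  by rewrite -[1 - P ^+ k]opprB subrX1 -mulNr opprB dvdp_mulr.
apply: (coprimep_dvdr (dvdX 'X^j u)).
rewrite -exprM mulnC uv addn1 exprS coprimep_sym.
have /dvdpP [P eqP] : qint n %| 1 - 'X^(v * n).
  rewrite mulnC exprM; apply: dvdp_trans (dvdX _ v).
  by rewrite -qintM dvdp_mull.
(* Modulo [n], the power X^(v n) is 1. *)
have -> : 1 - 'X * 'X^(v * n) = ('X * P) * qint n + (1 - 'X) :> {poly rat}.
  by rewrite -mulrA -eqP; ring.
rewrite coprimep_addl_mul -opprB -scaleN1r coprimepZr ?oppr_eq0 ?oner_eq0 //.
by rewrite coprimep_XsubC rootE qint_at1 Num.Theory.pnatr_eq0 -lt0n.
Qed.

(** * The first supplementary law *)

(** Euler's criterion for -1.  With m = (p-1)/2, a square root x of -1 has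
    1 = x^(2m) = (-1)^m.  Conversely X^m - 1 has too few roots to vanish on all
    p - 1 units, so some unit x has x^m = -1, and x^(m/2) is a square root of -1
    when m is even. *)
Lemma Fp_sqrtN1 p : prime p -> odd p ->
  [exists x : 'F_p, x ^+ 2 == -1] = ~~ odd p./2.
Proof.
move=> p_pr p_odd; have cardF : #|'F_p| = p by rewrite card_Fp.
have p2m : p = (p./2).*2.+1 by rewrite -[LHS]odd_double_half p_odd.
set m := p./2 in p2m *.
have m_gt0 : (0 < m)%N by have := prime_gt1 p_pr; lia.
have fermat (x : 'F_p) : x ^+ p = x by rewrite -[RHS]expf_card cardF.
have exp2m (x : 'F_p) : x != 0 -> (x ^+ m) ^+ 2 = 1.
  move=> x0; apply: (mulfI x0); rewrite -exprM muln2 -exprS -p2m.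
  by rewrite fermat mulr1.
apply/existsP/idP => [[x /eqP x2]|m_even].
  have x0 : x != 0.
    by apply: contra_eq_neq x2 => ->; rewrite expr0n eq_sym oppr_eq0 oner_eq0.
  have := exp2m x x0; rewrite -exprM mulnC exprM x2 -signr_odd.
  case: (odd m) => // /eqP; rewrite expr1 eq_sym -subr_eq0 opprK.
  rewrite -[1 + 1]/(2%:R) -(dvdn_pcharf (pchar_Fp p_pr)) => /dvdn_leq; lia.
have [x x0 xm] : exists2 x : 'F_p, x != 0 & x ^+ m != 1.
  apply/exists_inP; apply: contraT; rewrite negb_exists_in => /forall_inP all1.
  have := @max_poly_roots _ ('X^m - 1 : {poly 'F_p}) (enum (predC1 0)).
  rewrite -size_poly_eq0 size_XnsubC // enum_uniq -cardE cardC1 cardF.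
  have -> : all (root ('X^m - 1)) (enum (predC1 (0 : 'F_p))).
    apply/allP => x; rewrite mem_enum => /all1 /negPn /eqP xm.
    by rewrite rootE !hornerE xm subrr.
  by move=> /(_ isT isT isT); lia.
exists (x ^+ m./2); rewrite -exprM muln2.
have -> : (m./2).*2 = m by rewrite -[RHS]odd_double_half (negPf m_even).
by have /eqP := exp2m x x0; rewrite -[1](expr1n _ 2) eqf_sqr (negPf xm).
Qed.

Lemma legendreN1 p : prime p -> odd p -> legendre (-1) p = (-1) ^+ p./2.
Proof.
move=> p_pr p_odd; have p1 := prime_gt1 p_pr.
have sqE (x : nat) : (x%:Z ^+ 2 == -1 %[mod p])%Z = (x%:R ^+ 2 == -1 :> 'F_p).
  rewrite eqz_mod_dvd opprK -subr_eq0 opprK -natrX -PoszD dvdzE /=.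
  by rewrite (dvdn_pcharf (pchar_Fp p_pr)) natr1 addn1.
rewrite /legendre dvdzE /= dvdn1 gtn_eqF //.
have -> : [exists x : 'I_p, (x%:Z ^+ 2 == -1 %[mod p])%Z] = ~~ odd p./2.
  rewrite -Fp_sqrtN1 //; apply/existsP/existsP => [] [x].
    by rewrite sqE; exists x%:R.
  move=> x2; have xp : (x < p)%N by rewrite -[X in (_ < X)%N](Fp_cast p_pr).
  by exists (Ordinal xp); rewrite sqE natr_Zp.
by rewrite -signr_odd; case: odd.
Qed.

(** * The congruence *)

Lemma tofracX n : q ^+ n = tofrac 'X^n.
Proof. by rewrite rmorphXn. Qed.

Lemma tofrac_subX n : 1 - q ^+ n = tofrac (1 - 'X^n).
Proof. by rewrite rmorphB rmorph1 tofracX. Qed.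

Lemma qX_neq0 n : q ^+ n != 0.
Proof. by rewrite tofracX tofrac_eq0 expf_neq0 ?polyX_eq0. Qed.

Lemma subX_neq0 n : (0 < n)%N -> 1 - 'X^n != 0 :> {poly rat}.
Proof.
move=> n0; rewrite subr_eq0 eq_sym; apply/eqP => /(congr1 (size \o val)) /=.
by rewrite size_polyXn size_poly1; case: n n0.
Qed.

Lemma sqrMexp j : q ^+ 2 * (q ^+ 2) ^+ j = q ^+ (2 * j.+1).
Proof. by rewrite -exprS -exprM. Qed.

(** With u = Q^m one has x u = q^p at x = q, so the right-hand side carries the
    factor (1 - q^p)^2, while u^-1 and x^2 u are the parameters Q^(-m) and
    Q^(m+1). *)
Lemma shifted_factors (F : fieldType) (x u s : F) : u != 0 ->
  (1 - x * s) * (1 - x * s) - (1 - u^-1 * s) * (1 - x ^+ 2 * u * s)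
  = (1 - x * u) * (1 - x * u) * (s / u).
Proof. by move=> u0; field. Qed.

Lemma qpoch_shift_qcong m k :
  qcong m.*2.+1 2 (qpoch q (q ^+ 2) k ^+ 2)
    (qpoch ((q ^+ 2) ^- m) (q ^+ 2) k * qpoch ((q ^+ 2) ^+ m.+1) (q ^+ 2) k).
Proof.
set p := m.*2.+1; set Q : Qq := q ^+ 2.
have locQ n : qcong p 0 (Q ^+ n) 0.
  by rewrite -exprM tofracX; apply: qcong0_local.
have locQV n : qcong p 0 (Q ^- n) 0.
  rewrite -exprM tofracX; apply: qcong0_inv.
    by rewrite expf_neq0 ?polyX_eq0.
  by rewrite coprimep_expl ?coprime_X_qint.
have -> : qpoch = @qfact Qq by [].
rewrite expr2 !qfactM.
apply: (@qcong_prod p _ _ (fun j => (1 - q * Q ^+ j) * (1 - q * Q ^+ j))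
  (fun j => (1 - Q ^- m * Q ^+ j) * (1 - Q ^+ m.+1 * Q ^+ j))) => j.
- have lq : qcong p 0 (1 - q * Q ^+ j) 0.
    by rewrite -exprM -exprS tofrac_subX; apply: qcong0_local.
  exact: qcong0Mr.
- by apply: qcong0Mr; apply: qcong0_1B; apply: qcong0Mr.
rewrite -qcongE.
have -> : Q ^+ m.+1 = q ^+ 2 * Q ^+ m by rewrite exprS.
have Qm0 : Q ^+ m != 0 by rewrite -exprM qX_neq0.
rewrite [X in qcong _ _ X](shifted_factors q (Q ^+ j) Qm0).
apply: qcong0Mr; last exact: qcong0Mr.
have qp : qcong p 1 (1 - q * Q ^+ m) 0.
  rewrite -exprM -exprS mul2n tofrac_subX -qintM; apply: qcong0_poly.
  by rewrite expr1 dvdp_mull.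
exact: (@qcong0M _ 1%N 1%N).
Qed.

(** The factors are 1 - q^(2i) with 0 < i < p, and p divides no such 2i since it
    is odd. *)
Lemma qcong0_qpochV p k : prime p -> odd p -> (k < p)%N ->
  qcong p 0 (qpoch (q ^+ 2) (q ^+ 2) k)^-1 0.
Proof.
move=> p_pr p_odd; elim: k => [|k IHk] ltkp.
  rewrite /qpoch big_ord0 invr1 -(rmorph1 (@tofrac _)).
  exact: qcong0_local.
have -> : qpoch (q ^+ 2) (q ^+ 2) k.+1
    = qpoch (q ^+ 2) (q ^+ 2) k * (1 - q ^+ 2 * (q ^+ 2) ^+ k).
  exact: qfactSr.
rewrite invfM; apply: qcong0Mr; first by apply: IHk; apply: ltnW.
rewrite sqrMexp tofrac_subX; apply: qcong0_inv; first exact: subX_neq0.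
apply: coprime_subX_qint => //; first exact: prime_gt0.
rewrite coprime_sym prime_coprime // Euclid_dvdM // !gtnNdvd //.
by have := prime_gt1 p_pr; lia.
Qed.

Theorem corollary2p4 (p : nat) (p_prime : prime p) (p_odd : odd p) :
  qcong p 2
    (\sum_(0 <= k < p)
        qpoch q (q ^+ 2) k ^+ 2 / qpoch (q ^+ 2) (q ^+ 2) k ^+ 2 * q ^+ (2 * k))
    ((legendre (-1) p)%:~R * q ^+ ((p ^ 2 - 1) %/ 4)).
Proof.
have p2m : p = (p./2).*2.+1 by rewrite -[LHS]odd_double_half p_odd.
set m := p./2 in p2m; set Q : Qq := q ^+ 2.
have Q0 : Q != 0 := qX_neq0 2.
have nzQ j : 1 - Q * Q ^+ j != 0.
  by rewrite sqrMexp tofrac_subX tofrac_eq0 subX_neq0.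
have ltmp : (m < p)%N by lia.
(* The exponent is (p^2 - 1) / 4 = m (m + 1) = 2 * 'C(m+1, 2). *)
have -> : (legendre (-1) p)%:~R * q ^+ ((p ^ 2 - 1) %/ 4)
    = (-1) ^+ m * Q ^+ 'C(m.+1, 2).
  rewrite legendreN1 // -/m rmorphXn rmorphN1 -exprM -mul_bin_diag bin1.
  congr (_ * q ^+ _); rewrite p2m.
  have -> : (m.*2.+1 ^ 2 - 1 = 4 * (m.+1 * m))%N by lia.
  by rewrite mulKn.
rewrite -qcongE -(q_chu_vandermonde_diag Q0 nzQ ltmp) -sumrB.
apply: qcong0_sum => k ltkp; rewrite exprM -/Q -expr2 -!mulrBl -mulrA.
apply: qcong0Mr.
  by rewrite qcongE [X in qcong X]p2m; apply: qpoch_shift_qcong.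
apply: qcong0Mr; last by rewrite -exprM tofracX; apply: qcong0_local.
rewrite expr2 invfM.
by apply: qcong0Mr; apply: qcong0_qpochV.
Qed.
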